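(* For every $n,m\ge 1$, the uncovering-resilience of a synchronized communication system (SCS) whose communication graph is the $n\times m$ grid communication graph equals $$\frac{n\cdot m}{\gcd(n,m)}-1.$$
   Context: Model. A system consists of pairwise disjoint unit circles $C_1,\dots,C_N$ in the plane (trajectories) and a communication range $r>0$. Its communication graph $G$ has vertex set $\{C_1,\dots,C_N\}$, with $C_i,C_j$ adjacent iff the distance between their centres is at most $2+r$; $G$ is assumed connected. Positions on a circle are angles measured from the positive horizontal axis, taken modulo $2\pi$. For an edge $(i,j)$, the link position $\phi_{ij}$ is the angle of the point of $C_i$ closest to $C_j$. A schedule is a pair $F=(f,g)$ with $f(C_i)\in[0,2\pi)$ and $g(C_i)\in\{1,-1\}$ ($1$ = counterclockwise, $-1$ = clockwise); a robot following the schedule on $C_i$ is at angle $f(C_i)+g(C_i)\cdot 2\pi t$ at time $t$ (one time unit = one tour). $F$ is a synchronization schedule if $g(C_i)=-g(C_j)$ for every edge $(i,j)$ and, for every edge $(i,j)$, robots following $F$ on $C_i$ and $C_j$ are at $\phi_{ij}$ and $\phi_{ji}$ respectively at exactly the same times. A synchronized communication system (SCS) consists of $N$ identical robots, initially one on each circle, following a synchronization schedule $F$, with the switching rule: whenever a robot on $C_i$ reaches $\phi_{ij}$ at time $t$ and $C_j$ contains no robot, it instantly passes to $C_j$ and from then on follows the schedule of $C_j$ (at time $t+\varepsilon$ it is at $f(C_j)+g(C_j)2\pi(t+\varepsilon)$); if $C_j$ contains a robot (which is then at $\phi_{ji}$), the two meet and each stays on its own circle. A partial SCS is obtained from an SCS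 by letting some robots leave (possibly at different times); the remaining robots never leave. A circle is covered if every point of it is visited periodically by the surviving robots. The uncovering-resilience of an SCS is the largest number $k$ such that, whichever $k$ robots leave (at whatever times), all circles remain covered by the surviving robots. Grid. The $n\times m$ grid communication graph consists of $nm$ unit circles, circle $(i,j)$ lying in row $i\in\{1,\dots,n\}$ (rows horizontal, row 1 on top) and column $j\in\{1,\dots,m\}$ (columns vertical, column 1 on the left), with centres on a square lattice such that circle $(i,j)$ is adjacent in $G$ exactly to the circles $(i\pm1,j)$ and $(i,j\pm1)$ that exist. *)

(* Defs.v *)
From Stdlib Require Import Reals ZArith.
From mathcomp Require Import all_boot.

Set Implicit Arguments.
Unset Strict Implicit.
Unset Printing Implicit Defensive.

Local Open Scope R_scope.

(* The n x m grid communication graph.  Circle (i,j) with i : 'I_n the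
   row (row 0 = top row, rows increase downwards) and j : 'I_m the column
   (column 0 = leftmost, columns increase to the right).  Robots are
   identified with the circle they start on, so they also live in grid. *)
Definition grid (n m : nat) : finType := ('I_n * 'I_m)%type.

Definition adj (n m : nat) (c c' : grid n m) : Prop :=
  ((nat_of_ord c.1 = nat_of_ord c'.1) /\
     (nat_of_ord c'.2 = (nat_of_ord c.2).+1 \/ nat_of_ord c.2 = (nat_of_ord c'.2).+1))
  \/ ((nat_of_ord c.2 = nat_of_ord c'.2) /\
     (nat_of_ord c'.1 = (nat_of_ord c.1).+1 \/ nat_of_ord c.1 = (nat_of_ord c'.1).+1)).

(* link position phi_{c c'}: the angle of the point of c closest to c',
   i.e. the direction of the centre of c' seen from the centre of c
   (centres on a square lattice): right 0, up pi/2, left pi, down 3pi/2.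
   Only meaningful when adj c c'. *)
Definition phi (n m : nat) (c c' : grid n m) : R :=
  if nat_of_ord c'.2 == (nat_of_ord c.2).+1 then 0
  else if nat_of_ord c.2 == (nat_of_ord c'.2).+1 then PI
  else if nat_of_ord c'.1 == (nat_of_ord c.1).+1 then 3 * PI / 2
  else PI / 2.

Definition angeq (x y : R) : Prop := exists k : Z, x - y = IZR k * (2 * PI).

Definition sched_pos (n m : nat) (f g : grid n m -> R) (c : grid n m) (t : R) : R :=
  f c + g c * (2 * PI * t).

Definition sync_schedule (n m : nat) (f g : grid n m -> R) : Prop :=
  (forall c, 0 <= f c < 2 * PI) /\
  (forall c, g c = 1 \/ g c = -1) /\
  (forall c c', adj c c' ->
     g c' = - g c /\
     forall t, angeq (sched_pos f g c t) (phi c c') <->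
               angeq (sched_pos f g c' t) (phi c' c)).

Definition at_link (n m : nat) (f g : grid n m -> R) (c c' : grid n m) (t : R) : Prop :=
  angeq (sched_pos f g c t) (phi c c').

(* One transition at time t.  [prev k] is the circle of robot k just before
   t (None = robot has left), [now k] its circle from time t on.
   Leaving robots: those in S, robot k leaves at time tau k.
   Switching rule: a robot on c at link phi_{c c'} at time t passes to c'
   iff c' contains no robot; otherwise it stays. *)
Definition step_ok (n m : nat) (f g : grid n m -> R)
    (S : {set grid n m}) (tau : grid n m -> R)
    (prev : grid n m -> option (grid n m)) (t : R)
    (now : grid n m -> option (grid n m)) : Prop :=
  forall k : grid n m,
    match prev k with
    | None => now k = None
    | Some c =>
        ((k \in S) /\ tau k = t -> now k = None) /\
        (~ ((k \in S) /\ tau k = t) ->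
           (forall c', adj c c' -> at_link f g c c' t ->
              (forall k', prev k' <> Some c') -> now k = Some c') /\
           (~ (exists c', adj c c' /\ at_link f g c c' t /\
                 forall k', prev k' <> Some c') -> now k = Some c))
    end.

(* [pos k t] = circle of robot k during [t, t + eps) (None once it has left).
   A run of the partial SCS (robots in S leave at times tau) for t >= 0:
   piecewise constant (right- and left-locally constant), starting with
   robot k on circle k, and obeying step_ok at every time. *)
Definition is_run (n m : nat) (f g : grid n m -> R)
    (S : {set grid n m}) (tau : grid n m -> R)
    (pos : grid n m -> R -> option (grid n m)) : Prop :=
  (forall k t, 0 <= t -> exists eps, 0 < eps /\
      forall s, t <= s < t + eps -> pos k s = pos k t) /\
  step_ok f g S tau (fun k => Some k) 0 (fun k => pos k 0) /\
  (forall t, 0 < t -> exists eps, 0 < eps <= t /\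
      exists prev : grid n m -> option (grid n m),
        (forall k s, t - eps < s < t -> pos k s = prev k) /\
        step_ok f g S tau prev t (fun k => pos k t)).

(* Circle c is covered: every point of c is visited by a (surviving) robot
   at arbitrarily late times (the system is eventually periodic, so this is
   "visited periodically").  A robot is on c at time t if it is there on
   [t, t+eps) or on (t-eps, t). *)
Definition covered (n m : nat) (f g : grid n m -> R)
    (pos : grid n m -> R -> option (grid n m)) (c : grid n m) : Prop :=
  forall theta T : R, exists t, T <= t /\ 0 <= t /\
    angeq (sched_pos f g c t) theta /\
    exists k, pos k t = Some c \/
      (0 < t /\ exists eps, 0 < eps /\ forall s, t - eps < s < t -> pos k s = Some c).

Definition resilient (n m : nat) (f g : grid n m -> R) (k : nat) : Prop :=
  forall (S : {set grid n m}) (tau : grid n m -> R),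
    (#|S| <= k)%N ->
    (forall r, r \in S -> 0 <= tau r) ->
    forall pos, is_run f g S tau pos ->
    forall c, covered f g pos c.

Definition uncovering_resilience (n m : nat) (f g : grid n m -> R) (k : nat) : Prop :=
  resilient f g k /\ forall k', resilient f g k' -> (k' <= k)%N.

(* Main.v *)
(* Let robots that meet exchange names instead of turning back: the resulting
   tokens always cross to the neighbouring circle at a link.  The set of
   occupied circles is the same in both readings, and a departure kills exactly
   one token.  In the grid the links become active in turn, all even (or odd)
   horizontal ones together and all even (or odd) vertical ones together, so in
   one tour a token moves along its row by an m-cycle and, independently, along
   its column by an n-cycle.  Hence every token visits lcm(n,m) circles at a
   given phase of the tour, and these sets partition the circles into rings of
   lcm(n,m) tokens; a circle is uncovered iff all tokens of one ring are dead. *)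
Require Import Defs.
From Stdlib Require Import Reals ZArith Lra Lia Classical.
From mathcomp Require Import all_boot zify.

Set Implicit Arguments.
Unset Strict Implicit.
Unset Printing Implicit Defensive.

(** * Alternating neighbour swaps on a path *)

(* The ends without a partner stay put: N - 1 by the test, 0 because 0.-1 = 0. *)
Definition path_swap_nat (b : bool) (N i : nat) : nat :=
  if odd i (+) b then i.-1 else if i.+1 < N then i.+1 else i.

Lemma path_swap_lt (b : bool) (N : nat) (i : 'I_N) : path_swap_nat b N i < N.
Proof. by rewrite /path_swap_nat; have := ltn_ord i; repeat (case: ifP); lia. Qed.

Definition path_swap (b : bool) (N : nat) (i : 'I_N) : 'I_N :=
  Ordinal (path_swap_lt b i).

Arguments path_swap b {N} i.

Lemma path_swapK (b : bool) (N : nat) : involutive (@path_swap b N).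
Proof.
move=> i; apply: val_inj; rewrite /= /path_swap_nat; have := ltn_ord i.
by case: b; repeat (case: ifP); lia.
Qed.

(* The path folded out to a cycle of length 2N: a token that is about to move
   right from i sits at i, one that is about to move left at 2N - 1 - i. *)
Definition unfold (b : bool) (N : nat) (i : 'I_N) : nat :=
  if odd i (+) b then 2 * N - 1 - i else i.

(** Position parity and [b] change together, so a moving token keeps its direction and advances by
    one on the cycle. A token held at the right end passes from N - 1 to N, one held at the left end
    from 2N - 1 to 0, where alone the modulus matters. *)
Lemma unfold_path_swap (b : bool) (N : nat) (i : 'I_N) :
  unfold (~~ b) (path_swap b i) = (unfold b i).+1 %[mod 2 * N].
Proof.
have lt := ltn_ord i.
have [i0|ipos] := posnP i.
  rewrite /unfold /= /path_swap_nat i0 /=.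
  case: b => /=.
    by rewrite (_ : (2 * N - 1 - 0).+1 = 2 * N) ?modnn ?mod0n //; lia.
  by congr (_ %% _); case: (ltnP 1 N) => h /=; lia.
congr (_ %% _); rewrite /unfold /= /path_swap_nat.
by case: b; repeat (case: ifP); lia.
Qed.

Lemma unfold_inj (b : bool) (N : nat) (i j : 'I_N) :
  unfold b i = unfold b j %[mod 2 * N] -> i = j.
Proof.
have := ltn_ord i; have := ltn_ord j => lj li.
rewrite /unfold !modn_small; try by case: ifP => ?; lia.
by move=> h; apply: val_inj => /=; move: h; case: b; repeat (case: ifP); lia.
Qed.

Lemma unfold_iter (b : bool) (N k : nat) (i : 'I_N) :
  unfold b (iter k (path_swap (~~ b) \o path_swap b) i) =
    unfold b i + 2 * k %[mod 2 * N].
Proof.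
elim: k => [|k IHk]; first by rewrite muln0 addn0.
rewrite iterS; set j := iter k _ i in IHk *.
have := unfold_path_swap (~~ b) (path_swap b j); rewrite negbK => ->.
rewrite -addn1 -modnDml (unfold_path_swap b j) modnDml -addn1 -addnA.
by rewrite -modnDml IHk modnDml; congr (_ %% _); lia.
Qed.

(** A double swap advances by 2 on a cycle of length 2N, so a token is back exactly when 2N divides
    2k. *)
Lemma iter_path_swap_fixed (b : bool) (N k : nat) (i : 'I_N) :
  (iter k (path_swap (~~ b) \o path_swap b) i == i) = (N %| k).
Proof.
have e : (unfold b i + 2 * k == unfold b i %[mod 2 * N]) = (N %| k).
  by rewrite -{2}[unfold b i]addn0 eqn_modDl mod0n -[_ == 0]/(2 * N %| 2 * k) dvdn_pmul2l.
rewrite -e; apply/eqP/eqP => [fix_i | h]; first by rewrite -unfold_iter fix_i.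
by apply: (@unfold_inj b); rewrite unfold_iter.
Qed.

(** * Tokens on the grid and the length of their orbits *)

(** Events number the quarter turns. [h] will be true when circle (0,0) runs counterclockwise; it
    decides which half of the vertical links comes first. *)
Definition event (n m : nat) (h : bool) (e : nat) (c : grid n m) : grid n m :=
  if odd e then (path_swap ((e %% 4 == 3) (+) h) c.1, c.2)
  else (c.1, path_swap (e %% 4 == 2) c.2).

Lemma eventK (n m : nat) (h : bool) (e : nat) : involutive (@event n m h e).
Proof. case=> i j; rewrite /event; case: (odd e); congr pair; exact: path_swapK. Qed.

Lemma event_add4 (n m : nat) (h : bool) (e : nat) : @event n m h (e + 4) =1 event h e.
Proof. by move=> c; rewrite /event modnDr oddD addbF. Qed.

(** Events 1 to [e] are applied, so a token is named by its circle just after event 0. *)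
Fixpoint token (n m : nat) (h : bool) (e : nat) (x : grid n m) : grid n m :=
  if e is e'.+1 then event h e (token h e' x) else x.

Definition tour (n m : nat) (h : bool) (x : grid n m) : grid n m := token h 4 x.

Lemma token_inj (n m : nat) (h : bool) (e : nat) : injective (@token n m h e).
Proof.
by elim: e => [//|e IHe] x y /= /(can_inj (@eventK n m h e.+1)) /IHe.
Qed.

Lemma token_add4 (n m : nat) (h : bool) (e : nat) (x : grid n m) :
  token h (e + 4) x = token h e (tour h x).
Proof. by elim: e => [//|e IHe]; rewrite addSn /= IHe -addSn event_add4. Qed.

Lemma token_iter (n m : nat) (h : bool) (e z : nat) (x : grid n m) :
  token h (e + 4 * z) x = token h e (iter z (tour h) x).
Proof.
elim: z x => [|z IHz] x; first by rewrite muln0 addn0.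
by rewrite iterSr -IHz -token_add4; congr (token _ _ _); lia.
Qed.

(** Events 1 and 3 move only the row, events 2 and 4 only the column, so a tour is a product of two
    double swaps. *)
Lemma tourE (n m : nat) (h : bool) (x : grid n m) :
  tour h x = ((path_swap (~~ h) \o path_swap (~~ ~~ h)) x.1,
              (path_swap (~~ true) \o path_swap true) x.2).
Proof. by case: h; case: x. Qed.

Lemma iter_tour (n m : nat) (h : bool) (k : nat) (x : grid n m) :
  iter k (tour h) x = (iter k (path_swap (~~ h) \o path_swap (~~ ~~ h)) x.1,
              iter k (path_swap (~~ true) \o path_swap true) x.2).
Proof. by elim: k => [|k IHk]; [case: x | rewrite !iterS IHk tourE]. Qed.

Lemma tour_fixed (n m : nat) (h : bool) (k : nat) (x : grid n m) :
  (iter k (tour h) x == x) = (lcmn n m %| k).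
Proof.
case: x => i j; rewrite iter_tour -pair_eqE /= dvdn_lcm iter_path_swap_fixed; congr (_ && _).
by rewrite -[h in path_swap (~~ h)]negbK iter_path_swap_fixed.
Qed.

Lemma tour_inj (n m : nat) (h : bool) : injective (@tour n m h).
Proof. exact: token_inj. Qed.

Lemma order_tour (n m : nat) (h : bool) (x : grid n m) :
  0 < n -> 0 < m -> order (tour h) x = lcmn n m.
Proof.
move=> n0 m0; apply/eqP; rewrite eqn_dvd -(tour_fixed h _ x).
rewrite iter_order ?eqxx ?andbT; last exact: tour_inj.
have lpos : 0 < lcmn n m by rewrite lcmn_gt0 n0.
have fix_l : iter (lcmn n m) (tour h) x = x by apply/eqP; rewrite tour_fixed.
have per q : iter (q * order (tour h) x) (tour h) x = x.
  elim: q => [//|q IHq]; rewrite mulSn iterD IHq iter_order //; exact: tour_inj.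
move: fix_l; rewrite {1}(divn_eq (lcmn n m) (order (tour h) x)) addnC iterD per.
set r := _ %% _ => fix_r.
(* A return after fewer than [order] steps forces r = 0, because the index of [x] in its own orbit
   is 0. *)
have ltr : r < order (tour h) x by rewrite ltn_mod order_gt0.
have := findex_iter ltr; rewrite fix_r findex0 /dvdn => e.
by rewrite -/r -e.
Qed.

(** * Adjacency and the phases of links *)

(** Connectedness of the grid, used to spread the synchrony condition from the top left circle. *)
Lemma grid_ind (n m : nat) (P : grid n m -> Prop) :
  (forall c, nat_of_ord c.1 = 0%N -> nat_of_ord c.2 = 0%N -> P c) ->
  (forall c c', adj c c' -> P c -> P c') -> forall c, P c.
Proof.
move=> P0 Padj [i [j ltj]]; elim: j ltj => [|j IHj] ltj; last first.
  by apply: Padj (IHj (ltnW ltj)); left; split=> //=; left.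
case: i => i lti; elim: i lti => [|i IHi] lti; first exact: P0.
by apply: Padj (IHi (ltnW lti)); right; split=> //=; left.
Qed.

Definition link_phase (n m : nat) (h : bool) (c c' : grid n m) : nat :=
  if nat_of_ord c'.2 == c.2.+1 then (if odd c.2 then 2 else 0)%N
  else if nat_of_ord c.2 == c'.2.+1 then (if odd c.2 then 0 else 2)%N
  else if nat_of_ord c'.1 == c.1.+1 then (if odd c.1 (+) h then 3 else 1)%N
  else (if odd c.1 (+) h then 1 else 3)%N.

Lemma event_eq_link (n m : nat) (h : bool) (e : nat) (c c' : grid n m) :
  adj c c' -> (event h e c == c') = (e %% 4 == link_phase h c c')%N.
Proof.
have eO : odd e = odd (e %% 4) by lia.
have : (e %% 4 < 4)%N by rewrite ltn_mod.
rewrite /event eO; move: (e %% 4)%N => {eO e} e lte.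
case: c c' => i j [i' j']; have li := ltn_ord i; have lj := ltn_ord j.
have li' := ltn_ord i'; have lj' := ltn_ord j'.
rewrite /adj /= => a.
have -> : ((if odd e then (path_swap ((e == 3) (+) h) i, j)
       else (i, path_swap (e == 2) j)) == (i', j')) =
   if odd e then (path_swap_nat ((e == 3) (+) h) n i == i') && (j == j' :> nat)
   else (path_swap_nat (e == 2) m j == j') && (i == i' :> nat).
  by case: ifP => _; rewrite -pair_eqE //= andbC.
rewrite /link_phase /path_swap_nat /=.
case: e lte => [|[|[|[|//]]]] _ /=; case: h => /=;
case: a => -[E [E'|E']]; repeat (case: ifP); lia.
Qed.

Lemma event_adj (n m : nat) (h : bool) (e : nat) (c : grid n m) :
  event h e c <> c -> adj c (event h e c).
Proof.
case: c => i j; rewrite /event; case: ifP => _ ne; [right | left]; split=> //=;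
  rewrite /path_swap_nat.
- have : path_swap ((e %% 4 == 3) (+) h) i != i :> nat.
    by apply/eqP=> e0; apply: ne; congr pair; apply: val_inj.
  by rewrite /= /path_swap_nat; repeat (case: ifP); lia.
- have : path_swap (e %% 4 == 2) j != j :> nat.
    by apply/eqP=> e0; apply: ne; congr pair; apply: val_inj.
  by rewrite /= /path_swap_nat; repeat (case: ifP); lia.
Qed.

(** * Angles and synchronized schedules *)

Local Open Scope R_scope.

Lemma angeq_refl (x : R) : angeq x x.
Proof. by exists 0%Z; lra. Qed.

Lemma angeq_sym (x y : R) : angeq x y -> angeq y x.
Proof. by case=> k e; exists (- k)%Z; rewrite opp_IZR; lra. Qed.

Lemma angeq_trans (x y z : R) : angeq x y -> angeq y z -> angeq x z.
Proof. by case=> k e [l e']; exists (k + l)%Z; rewrite plus_IZR; lra. Qed.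

Ltac angeq_near k :=
  first [ exists k; lra
        | exists (k + 1)%Z; rewrite plus_IZR; lra
        | exists (k - 1)%Z; rewrite minus_IZR; lra ].

Definition sgn (b : bool) : R := if b then -1 else 1.

(* The angle of circle (i,j) in clock units of a quarter turn: v = 4t + s runs
   over the integers exactly when robots reach link positions.  The synchrony
   condition makes horizontal neighbours mirror images with respect to a
   vertical line and vertical neighbours with respect to a horizontal one. *)
Definition clock_angle (n m : nat) (h : bool) (c : grid n m) (v : R) : R :=
  sgn (odd c.1 (+) odd c.2) * (sgn (~~ h) * (PI / 2 * v)) +
  (if odd c.2 then PI else 0).

Definition phased (n m : nat) (f g : grid n m -> R) (h : bool) (s : R) : Prop :=
  0 <= s /\ forall c t, angeq (sched_pos f g c t) (clock_angle h c (4 * t + s)).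

(** Opposite directions make the sum of the two angles constant in time, so it can be read off when
    both robots are at the link. *)
Lemma sched_pos_add (n m : nat) (f g : grid n m -> R) (c c' : grid n m) (t : R) :
  sync_schedule f g -> adj c c' ->
  angeq (sched_pos f g c t + sched_pos f g c' t) (phi c c' + phi c' c).
Proof.
case=> [_ [gE sync]] a; have [gc lnk] := sync _ _ a.
have pi0 := PI_RGT_0.
pose t0 := g c * (phi c c' - f c) / (2 * PI).
have e0 : sched_pos f g c t0 = phi c c'.
  by rewrite /sched_pos /t0; case: (gE c) => ->; field; lra.
have := proj1 (lnk t0); rewrite e0 => /(_ (angeq_refl _)) [k e]; exists k.
rewrite -e -e0 /sched_pos gc; ring.
Qed.

Lemma phi_right (n m : nat) (c c' : grid n m) :
  nat_of_ord c'.2 = c.2.+1 -> phi c c' = 0.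
Proof. by move=> e; rewrite /phi e eqxx. Qed.

Lemma phi_left (n m : nat) (c c' : grid n m) :
  nat_of_ord c.2 = c'.2.+1 -> phi c c' = PI.
Proof. by move=> e; rewrite /phi e eqxx (_ : _ == _ = false) //; lia. Qed.

Lemma phi_down (n m : nat) (c c' : grid n m) :
  nat_of_ord c.2 = c'.2 -> nat_of_ord c'.1 = c.1.+1 -> phi c c' = 3 * PI / 2.
Proof. by move=> e e1; rewrite /phi e e1 eqxx (_ : _ == _ = false) //; lia. Qed.

Lemma phi_up (n m : nat) (c c' : grid n m) :
  nat_of_ord c.2 = c'.2 -> nat_of_ord c.1 = c'.1.+1 -> phi c c' = PI / 2.
Proof.
move=> e e1; rewrite /phi e e1 (_ : _ == _ = false); last by lia.
by rewrite (_ : _ == _ = false) //; lia.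
Qed.

(** Clock angles obey the same reflection law: either sum is PI for horizontal and 2 PI for vertical
    neighbours, up to full turns. *)
Lemma clock_angle_adj (n m : nat) (f g : grid n m -> R) (h : bool) (c c' : grid n m) (t v : R) :
  sync_schedule f g -> adj c c' ->
  angeq (sched_pos f g c t) (clock_angle h c v) ->
  angeq (sched_pos f g c' t) (clock_angle h c' v).
Proof.
move=> sync a [k e]; have [l e'] := sched_pos_add t sync a.
have {e e'} : sched_pos f g c' t =
    phi c c' + phi c' c - clock_angle h c v + IZR (l - k) * (2 * PI).
  by rewrite minus_IZR; lra.
move: (l - k)%Z => {l k} k; rewrite /clock_angle.
move: (sgn (~~ h) * _) => x.
case: a => -[e [e'|e']].
- rewrite (phi_right e') (phi_left e') -e e' /=.
  by case: (odd c.1); case: (odd c.2) => /= ->; angeq_near k.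
- rewrite (phi_right e') (phi_left e') -e e' /=.
  by case: (odd c.1); case: (odd c'.2) => /= ->; angeq_near k.
- rewrite (phi_down e e') (phi_up (esym e) e') -e e' /=.
  by case: (odd c.1); case: (odd c.2) => /= ->; angeq_near k.
- rewrite (phi_down (esym e) e') (phi_up e e') -e e' /=.
  by case: (odd c'.1); case: (odd c.2) => /= ->; angeq_near k.
Qed.

Lemma sync_phased (n m : nat) (f g : grid n m -> R) :
  (0 < n)%N -> (0 < m)%N -> sync_schedule f g -> exists h s, phased f g h s.
Proof.
move=> n0 m0 sync; pose c0 : grid n m := (Ordinal n0, Ordinal m0).
have [fE [gE _]] := sync; have [f0 f1] := fE c0; have pi0 := PI_RGT_0.
have [h [s [s0 base]]] : exists h s, 0 <= s /\
    forall t, angeq (sched_pos f g c0 t) (clock_angle h c0 (4 * t + s)).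
  have fpi : 0 <= f c0 / (PI / 2) < 4.
    have e : f c0 = f c0 / (PI / 2) * (PI / 2) by field; lra.
    by split; nra.
  case: (gE c0) => g0.
    exists true, (f c0 / (PI / 2)); split; first lra.
    move=> t; exists 0%Z; rewrite /sched_pos /clock_angle g0 /=; field; lra.
  (* Clockwise, the reading is minus the angle in quarter turns; adding a full turn keeps it
     nonnegative. *)
  exists false, (4 - f c0 / (PI / 2)); split; first lra.
  move=> t; exists 1%Z; rewrite /sched_pos /clock_angle g0 /=; field; lra.
exists h, s; split=> // c t; elim/grid_ind: c => [c i0 j0 | c c' a].
  suff -> : c = c0 by exact: base.
  by rewrite [c]surjective_pairing; congr pair; apply: val_inj.
exact: clock_angle_adj.
Qed.

Lemma angeq_quarter (x y : R) :
  angeq (PI / 2 * x) (PI / 2 * y) <-> exists k : Z, x = y + 4 * IZR k.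
Proof.
have pi0 := PI_RGT_0; split=> -[k e]; exists k; last by rewrite e; field.
by apply: (Rmult_eq_reg_l (PI / 2)); lra.
Qed.

(** In quarter turns, being at a link is a congruence modulo 4. Negating it removes the sign of
    rotation, and each of the four directions is then a finite check of residues. *)
Lemma at_link_phase (n m : nat) (f g : grid n m -> R) (h : bool) (s : R)
    (c c' : grid n m) (t : R) :
  phased f g h s -> adj c c' ->
  at_link f g c c' t <->
  exists k : Z, 4 * t + s = IZR (Z.of_nat (link_phase h c c') + 4 * k).
Proof.
case=> s0 ph a; have {ph} ph := ph c t; have pi0 := PI_RGT_0.
have -> : at_link f g c c' t <-> angeq (clock_angle h c (4 * t + s)) (phi c c').
  by split; apply: angeq_trans => //; apply: angeq_sym.
have quarters x (p : Z) (sg : bool) : (exists k, sgn sg * x = IZR (p + 4 * k)) <->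
    exists k, x = IZR ((if sg then (- p)%Z else p) + 4 * k).
  split=> -[k e]; case: sg e => e; [exists (- k)%Z|exists k|exists (- k)%Z|exists k];
    move: e; rewrite /sgn !plus_IZR !mult_IZR ?opp_IZR; lra.
have shift x (p r : Z) : (r = p \/ r = p + 4 \/ r = p - 4)%Z ->
    (exists k, x = IZR (p + 4 * k)) <-> (exists k, x = IZR (r + 4 * k)).
  by case=> [|[|]] ->; split=> -[k ->];
    solve [exists k; congr IZR; lia | exists (k + 1)%Z; congr IZR; lia | exists (k - 1)%Z; congr IZR; lia].
have key (p : Z) : phi c c' = PI / 2 * IZR p ->
    angeq (clock_angle h c (4 * t + s)) (phi c c') <->
    exists k, sgn (odd c.1 (+) odd c.2) * (sgn (~~ h) * (4 * t + s)) =
       IZR (p - (if odd c.2 then 2%Z else 0%Z) + 4 * k).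
  move=> ->; rewrite (_ : clock_angle _ _ _ = PI / 2 *
    (sgn (odd c.1 (+) odd c.2) * (sgn (~~ h) * (4 * t + s)) +
     IZR (if odd c.2 then 2%Z else 0%Z))); last first.
    by rewrite /clock_angle; case: (odd c.2) => /=; lra.
  rewrite angeq_quarter; split=> -[k e]; exists k;
    move: e; rewrite plus_IZR minus_IZR mult_IZR; lra.
rewrite /link_phase.
case: a => -[e [e'|e']].
- rewrite (key 0%Z) ?(phi_right e'); last lra.
  rewrite quarters quarters e' eqxx; apply: shift => //.
  by case: (odd c.1); case: (odd c.2); case: (h) => /=; lia.
- rewrite (key 2%Z) ?(phi_left e'); last lra.
  rewrite quarters quarters e' eqxx (_ : _ == _ = false); last lia.
  apply: shift => //.
  by case: (odd c.1); case: (odd c'.2.+1); case: (h) => /=; lia.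
- rewrite (key 3%Z) ?(phi_down e e'); last lra.
  rewrite quarters quarters e e' eqxx ltn_eqF //.
  apply: shift => //.
  by case: (odd c.1); case: (odd c'.2); case: (h) => /=; lia.
- rewrite (key 1%Z) ?(phi_up e e'); last lra.
  rewrite quarters quarters e e' (ltn_eqF (ltnSn c'.2)).
  rewrite (ltn_eqF (leqW (ltnSn c'.1))).
  apply: shift => //.
  by case: (odd c'.1.+1); case: (odd c'.2); case: (h) => /=; lia.
Qed.

Lemma at_linkP (n m : nat) (f g : grid n m -> R) (h : bool) (s : R)
    (c c' : grid n m) (t : R) :
  phased f g h s -> adj c c' -> 0 <= t ->
  at_link f g c c' t <-> exists2 e : nat, 4 * t + s = INR e & event h e c = c'.
Proof.
move=> ph a t0; rewrite (at_link_phase t ph a); have [s0 _] := ph.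
split=> [[k e] | [e eqt /eqP]].
  set p := link_phase _ _ _ in e.
  have k0 : (0 <= Z.of_nat p + 4 * k)%Z by apply: le_IZR; lra.
  exists (Z.to_nat (Z.of_nat p + 4 * k)); first by rewrite INR_IZR_INZ Z2Nat.id.
  apply/eqP; rewrite event_eq_link // -/p.
  have : (p < 4)%N by rewrite /p /link_phase; repeat (case: ifP).
  lia.
rewrite event_eq_link // => /eqP h4; exists (Z.of_nat (e %/ 4)).
rewrite eqt INR_IZR_INZ; congr IZR; lia.
Qed.

(** * The clock and induction along real time *)

Definition clock (s t : R) : nat := Z.to_nat (Int_part (4 * t + s)).

Lemma clock_bounds (s t : R) : 0 <= s -> 0 <= t ->
  INR (clock s t) <= 4 * t + s < INR (clock s t) + 1.
Proof.
move=> s0 t0; have [lo hi] := base_Int_part (4 * t + s).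
have z0 : (0 <= Int_part (4 * t + s))%Z.
  by apply/Z.lt_succ_r; apply: lt_IZR; rewrite succ_IZR; lra.
by rewrite INR_IZR_INZ Z2Nat.id //; lra.
Qed.

Lemma clock_unique (s t : R) (e : nat) :
  INR e <= 4 * t + s < INR e + 1 -> clock s t = e.
Proof.
rewrite INR_IZR_INZ => -[lo hi].
by rewrite /clock -(Int_part_spec (4 * t + s) (Z.of_nat e)) ?Nat2Z.id //; lra.
Qed.

Lemma clock_right (s t : R) : 0 <= s -> 0 <= t ->
  exists eps, 0 < eps /\ forall u, t <= u < t + eps -> clock s u = clock s t.
Proof.
move=> s0 t0; have [lo hi] := clock_bounds s0 t0.
exists ((INR (clock s t) + 1 - (4 * t + s)) / 4); split; first lra.
by move=> u u_near; apply: clock_unique; lra.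
Qed.

Lemma clock_left (s t : R) : 0 <= s -> 0 < t ->
  exists eps e, [/\ 0 < eps <= t, forall u, t - eps < u < t -> clock s u = e &
    (4 * t + s = INR (clock s t) /\ clock s t = e.+1) \/
    ((forall e', 4 * t + s <> INR e') /\ clock s t = e)].
Proof.
move=> s0 t0; have [lo hi] := clock_bounds s0 (Rlt_le _ _ t0).
have [int|nint] := Req_dec (4 * t + s) (INR (clock s t)).
  have [e eE] : exists e, clock s t = e.+1.
    case E: (clock s t) int => [|e] /= int; last by exists e.
    by rewrite E /= in lo hi; lra.
  (* A time of 1/4 is one clock unit, the gap between consecutive events. *)
  exists (Rmin (1 / 4) t), e; have m1 := Rmin_l (1 / 4) t; have m2 := Rmin_r (1 / 4) t.
  have m3 : 0 < Rmin (1 / 4) t by apply: Rmin_glb_lt; lra.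
  split; [lra | | by left].
  move=> u u_near; apply: clock_unique.
  by rewrite eE S_INR in int; lra.
have [d dE] : exists d, d = (4 * t + s - INR (clock s t)) / 4 by eexists.
exists (Rmin d t), (clock s t); have m1 := Rmin_l d t; have m2 := Rmin_r d t.
have m3 : 0 < Rmin d t by apply: Rmin_glb_lt; lra.
split; [lra | | right; split=> //].
  by move=> u u_near; apply: clock_unique; lra.
by move=> e' e'E; apply: nint; rewrite (@clock_unique s t e') //; lra.
Qed.

(** Let M be the supremum of the times up to which [P] holds throughout. The third hypothesis gives
    [P] at M, and the second carries it beyond M. *)
Lemma real_induction (P : R -> Prop) :
  P 0 ->
  (forall t, 0 <= t -> P t -> exists eps, 0 < eps /\ forall u, t <= u < t + eps -> P u) ->
  (forall t, 0 < t -> (forall u, 0 <= u < t -> P u) -> P t) ->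
  forall t, 0 <= t -> P t.
Proof.
move=> P0 Pright Pleft T T0; apply: NNPP => nPT.
pose E x := 0 <= x /\ forall u, 0 <= u <= x -> P u.
have E0 : E 0 by split=> [|u u0]; [lra | have -> : u = 0 by lra].
have E_ub x : E x -> x <= T.
  by case=> x0 Px; case: (Rle_lt_dec x T) => // lt; case: nPT; apply: Px; lra.
have [M [M_ub M_least]] := completeness E (ex_intro _ T E_ub) (ex_intro _ 0 E0).
have M0 : 0 <= M := M_ub _ E0.
have below u : 0 <= u < M -> P u.
  move=> uM; apply: NNPP => nPu; suff : M <= u by lra.
  apply: M_least => x [x0 Px]; case: (Rle_lt_dec x u) => // lt.
  by case: nPu; apply: Px; lra.
have PM : P M.
  have [Mpos|M00] : 0 < M \/ M = 0 by lra.
    exact: Pleft.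
  by rewrite M00.
have [eps [eps0 near_M]] := Pright M M0 PM.
suff : M + eps / 2 <= M by lra.
apply: M_ub; split; first lra.
move=> u u_le; case: (Rle_lt_dec M u) => lt; first by apply: near_M; lra.
by apply: below; lra.
Qed.

(** * A single transition *)

Definition no_sharing (n m : nat) (p : grid n m -> option (grid n m)) : Prop :=
  forall k1 k2 d, p k1 = Some d -> p k2 = Some d -> k1 = k2.

(** The active links at one time form a matching, recorded as an involution whose fixed points have
    no active link. *)
Definition links_by (n m : nat) (f g : grid n m -> R) (t : R)
    (swap : grid n m -> grid n m) : Prop :=
  [/\ involutive swap, forall c, swap c <> c -> adj c (swap c) &
      forall c c', adj c c' -> at_link f g c c' t <-> swap c = c'].

(** The only candidate for [c'] is the partner [swap c]. Where [swap] fixes [c], that place is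
    occupied by the robot itself, so it stays. *)
Lemma step_okP (n m : nat) (f g : grid n m -> R) (S : {set grid n m})
    (tau : grid n m -> R) (prev : grid n m -> option (grid n m)) (t : R)
    (now : grid n m -> option (grid n m)) (swap : grid n m -> grid n m) :
  links_by f g t swap ->
  step_ok f g S tau prev t now <->
  forall k, match prev k with
    | None => now k = None
    | Some c =>
        ((k \in S) /\ tau k = t -> now k = None) /\
        (~ ((k \in S) /\ tau k = t) ->
          ((forall k', prev k' <> Some (swap c)) -> now k = Some (swap c)) /\
          ((exists k', prev k' = Some (swap c)) -> now k = Some c))
    end.
Proof.
case=> swapK swap_adj swap_link.
split=> ok k; have := ok k; case pk: (prev k) => [c|//] [leave stay];
  split=> // nleave; have [move_ok stay_ok] := stay nleave; split.
- move=> empty; apply: move_ok => //; last first.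
    by apply/swap_link=> //; apply: swap_adj => e; apply: (empty k); rewrite pk e.
  by apply: swap_adj => e; apply: (empty k); rewrite pk e.
- move=> [k' pk']; apply: stay_ok => -[c' [a [lnk empty]]].
  by apply: (empty k'); rewrite pk'; congr Some; apply/swap_link.
- move=> c' a lnk empty.
  by have e := proj1 (swap_link _ _ a) lnk; rewrite -e; apply: move_ok; rewrite e.
- move=> nmove; apply: stay_ok; apply: NNPP => nex; apply: nmove.
  exists (swap c).
  have empty k' : prev k' <> Some (swap c) by move=> pk'; apply: nex; exists k'.
  have a : adj c (swap c) by apply: swap_adj => e; apply: (empty k); rewrite pk e.
  by split=> //; split=> //; apply/swap_link.
Qed.

(** Here robots give way to tokens: a robot found on [d] either came from [swap d] or stayed because
    it met a robot there, so [swap d] was occupied. Departures can break only the converse. *)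
Lemma step_preserves (n m : nat) (f g : grid n m -> R) (S : {set grid n m})
    (tau : grid n m -> R) (prev : grid n m -> option (grid n m)) (t : R)
    (now : grid n m -> option (grid n m)) (swap : grid n m -> grid n m) :
  links_by f g t swap -> step_ok f g S tau prev t now -> no_sharing prev ->
  [/\ no_sharing now,
      forall k, k \notin S -> prev k <> None -> now k <> None &
      forall k d, now k = Some d -> exists k', prev k' = Some (swap d)].
Proof.
move=> lb /(step_okP _ _ _ _ lb) ok inj; have [swapK _ _] := lb.
have cases k d : now k = Some d -> exists2 c, prev k = Some c &
    d = swap c /\ (forall k', prev k' <> Some (swap c)) \/
    d = c /\ exists k', prev k' = Some (swap c).
  have := ok k; case: (prev k) => [c|->//] [leave stay] nk; exists c => //.
  have nleave : ~ (k \in S /\ tau k = t) by move=> /leave; rewrite nk.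
  have [move_ok stay_ok] := stay nleave.
  case: (classic (exists k', prev k' = Some (swap c))) => [ex|nex].
    by right; split=> //; move: (stay_ok ex); rewrite nk => -[].
  have empty k' : prev k' <> Some (swap c) by move=> pk'; apply: nex; exists k'.
  by left; split=> //; move: (move_ok empty); rewrite nk => -[].
split.
- move=> k1 k2 d /cases [c1 p1 h1] /cases [c2 p2 h2].
  case: h1 => -[d1 h1]; case: h2 => -[d2 h2].
  + by apply: (inj _ _ c1) => //; rewrite p2 -[c1]swapK -d1 d2 swapK.
  + by case: (h1 k2); rewrite p2 -d2 d1.
  + by case: (h2 k1); rewrite p1 -d1 d2.
  + by apply: (inj _ _ d); [rewrite d1 | rewrite d2].
- move=> k kS; have := ok k; case: (prev k) => [c|//] [_ stay] _.
  have [|move_ok stay_ok] := stay; first by case; rewrite (negPf kS).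
  case: (classic (exists k', prev k' = Some (swap c))) => [/stay_ok ->//|nex].
  by rewrite move_ok // => k' pk'; apply: nex; exists k'.
- move=> k d /cases [c pc [[-> _]|[-> //]]].
  by exists k; rewrite swapK.
Qed.

Lemma links_event (n m : nat) (f g : grid n m -> R) (h : bool) (s t : R) (e : nat) :
  phased f g h s -> 0 <= t -> 4 * t + s = INR e -> links_by f g t (event h e).
Proof.
move=> ph t0 eE; split; [exact: eventK | exact: event_adj | move=> c c' a].
rewrite (at_linkP ph a t0); split=> [[e' e'E <-]|<-]; last by exists e.
by congr (event _ _ _); apply: INR_eq; rewrite -eE.
Qed.

Lemma links_id (n m : nat) (f g : grid n m -> R) (h : bool) (s t : R) :
  phased f g h s -> 0 <= t -> (forall e, 4 * t + s <> INR e) -> links_by f g t id.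
Proof.
move=> ph t0 nint; split=> // c c' a.
rewrite (at_linkP ph a t0); split=> [[e /nint //]|ecc].
by move: a; rewrite ecc /adj; lia.
Qed.

Lemma links_exist (n m : nat) (f g : grid n m -> R) (h : bool) (s t : R) :
  phased f g h s -> 0 <= t -> exists swap, links_by f g t swap.
Proof.
move=> ph t0; case: (classic (exists e, 4 * t + s = INR e)) => [[e eE]|nint].
  by exists (event h e); apply: links_event eE.
by exists id; apply: (links_id ph t0) => e eE; apply: nint; exists e.
Qed.

Lemma links_before (n m : nat) (f g : grid n m -> R) (h : bool) (s t : R) :
  phased f g h s -> 0 < t ->
  exists eps e swap, [/\ 0 < eps <= t, forall u, t - eps < u < t -> clock s u = e,
    links_by f g t swap &
    swap = event h e.+1 /\ clock s t = e.+1 \/ swap = id /\ clock s t = e].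
Proof.
move=> ph t0; have [s0 _] := ph; have t00 := Rlt_le _ _ t0.
have [eps [e [eps0 before [[int eE]|[nint eE]]]]] := clock_left s0 t0.
  exists eps, e, (event h e.+1); split=> //; last by left.
  by apply: (links_event ph) => //; rewrite -eE.
by exists eps, e, id; split=> //; [exact: links_id ph t00 nint | right].
Qed.

Lemma uniform_eps (T : finType) (P : T -> R -> Prop) :
  (forall k, exists eps, 0 < eps /\ P k eps) ->
  (forall k d eps, d <= eps -> P k eps -> P k d) ->
  exists eps, 0 < eps /\ forall k, P k eps.
Proof.
move=> ex mono.
have [eps [eps0 all_eps]] : exists eps, 0 < eps /\ forall k, k \in enum T -> P k eps.
  elim: (enum T) => [|k ks [eps [eps0 IH]]]; first by exists 1; split; [lra|].
  have [d [d0 Pd]] := ex k; have m1 := Rmin_l d eps; have m2 := Rmin_r d eps.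
  exists (Rmin d eps); split; first exact: Rmin_glb_lt.
  by move=> l; rewrite inE => /orP[/eqP-> | /IH]; [exact: mono m1 Pd | exact: mono m2].
by exists eps; split=> // k; apply: all_eps; rewrite mem_enum.
Qed.

(** * Tokens along a run *)

Definition carried (n m : nat) (h : bool) (s : R)
    (pos : grid n m -> R -> option (grid n m)) (x : grid n m) (t : R) : Prop :=
  exists k, pos k t = Some (token h (clock s t) x).

(** The last clause says that a dead token never revives. The clauses are proved together because
    the transition at [t] needs distinct positions just before [t]. *)
Lemma run_invariant (n m : nat) (f g : grid n m -> R) (h : bool) (s : R)
    (S : {set grid n m}) (tau : grid n m -> R)
    (pos : grid n m -> R -> option (grid n m)) :
  phased f g h s -> is_run f g S tau pos -> forall t, 0 <= t ->
  [/\ no_sharing (pos^~ t), forall k, k \notin S -> pos k t <> None &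
      forall u x, 0 <= u <= t -> carried h s pos x t -> carried h s pos x u].
Proof.
move=> ph [right_const [init left_step]]; have [s0 _] := ph.
apply: real_induction.
- have [swap lb] := links_exist ph (Rle_refl 0).
  have [|inj alive _] := step_preserves lb init; first by move=> k1 k2 d [->] [->].
  split=> //; first by move=> k /alive; apply.
  by move=> u x u0; have -> : u = 0 by lra.
- move=> t t0 [inj alive anti].
  have [eps [eps0 pos_eps]] : exists eps, 0 < eps /\
      forall k u, t <= u < t + eps -> pos k u = pos k t.
    apply: uniform_eps => [k|k d eps ded eps_ok u ut]; first exact: right_const.
    by apply: eps_ok; lra.
  have [d [d0 clock_d]] := clock_right s0 t0.
  have m1 := Rmin_l d eps; have m2 := Rmin_r d eps.
  exists (Rmin d eps); split; first exact: Rmin_glb_lt.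
  have carried_eq u x : t <= u < t + Rmin d eps ->
      carried h s pos x u <-> carried h s pos x t.
    move=> ut; have pos_u k : pos k u = pos k t by apply: pos_eps; lra.
    rewrite /carried clock_d; last lra.
    by split=> -[k pk]; exists k; [rewrite -pos_u | rewrite pos_u].
  move=> u ut; have pos_u k : pos k u = pos k t by apply: pos_eps; lra.
  split; [by move=> k1 k2 c; rewrite !pos_u; exact: inj | |].
  + by move=> k; rewrite pos_u; exact: alive.
  + move=> u' x u'u /carried_eq - /(_ ut) c; case: (Rle_lt_dec t u') => lt.
      by apply/carried_eq => //; lra.
    by apply: anti c; lra.
- move=> t t0 IH.
  have [eps [eps0 [prev [prevE step]]]] := left_step t t0.
  have [d [e [swap [d0 clockE lb swapE]]]] := links_before ph t0.
  have m1 := Rmin_l d eps; have m2 := Rmin_r d eps.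
  have m3 : 0 < Rmin d eps by apply: Rmin_glb_lt; lra.
  have near u : t - Rmin d eps < u < t -> (forall k, pos k u = prev k) /\ clock s u = e.
    by move=> ut; split=> [k|]; [apply: prevE|apply: clockE]; lra.
  have [u0 u0t] : exists u0, t - Rmin d eps < u0 < t.
    by exists (t - Rmin d eps / 2); lra.
  have [inj0 alive0 _] := IH u0 ltac:(lra).
  have [pos0 _] := near _ u0t.
  have [|inj alive back] := step_preserves lb step.
    by move=> k1 k2 c; rewrite -!pos0; exact: inj0.
  split=> //; first by move=> k kS; apply: alive => //; rewrite -pos0; exact: alive0.
  move=> u x ut ct; have [eut|ltut] : u = t \/ u < t by lra.
    by rewrite eut.
  (* [w] lies just before [t] and not before [u]: the token is traced back over the transition to
     [w], and from there to [u]. *)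
  pose w := Rmax u u0; have w1 := Rmax_l u u0; have w2 := Rmax_r u u0.
  have w3 : w < t by apply: Rmax_lub_lt; lra.
  have [posw clockw] := near w ltac:(rewrite /w in w3 *; lra).
  have [_ _ anti] := IH w ltac:(rewrite /w in w3 *; lra).
  apply: anti; first by rewrite /w; lra.
  case: ct => k /back [k' pk']; exists k'; rewrite posw pk' clockw; congr Some.
  by case: swapE => -[-> ->] //=; rewrite eventK.
Qed.

(** * Lower bound: fewer than lcm(n,m) departures uncover nothing *)

Lemma sched_pos_reaches (n m : nat) (f g : grid n m -> R) (c : grid n m) (theta T : R) :
  g c = 1 \/ g c = -1 -> exists t, T <= t /\ angeq (sched_pos f g c t) theta.
Proof.
have pi0 := PI_RGT_0 => gc.
pose t0 := g c * (theta - f c) / (2 * PI); have [up_gt _] := archimed (T - t0).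
exists (t0 + IZR (up (T - t0))); split; first lra.
case: gc => gc; [exists (up (T - t0))| exists (- up (T - t0))%Z];
  rewrite ?opp_IZR /sched_pos /t0 gc; field; lra.
Qed.

Lemma clock_add (s t : R) (z : nat) : 0 <= s -> 0 <= t ->
  clock s (t + INR z) = (clock s t + 4 * z)%N.
Proof.
move=> s0 t0; have bd := clock_bounds s0 t0; apply: clock_unique.
by rewrite plus_INR mult_INR /=; lra.
Qed.

Lemma sched_pos_add_turns (n m : nat) (f g : grid n m -> R) (c : grid n m) (t : R) (z : nat) :
  g c = 1 \/ g c = -1 -> angeq (sched_pos f g c (t + INR z)) (sched_pos f g c t).
Proof.
by case=> gc; [exists (Z.of_nat z)|exists (- Z.of_nat z)%Z];
  rewrite ?opp_IZR -INR_IZR_INZ /sched_pos gc; lra.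
Qed.

Lemma card_ring (n m : nat) (h : bool) (e : nat) (x : grid n m) :
  (0 < n)%N -> (0 < m)%N ->
  #|[set token h e y | y in orbit (tour h) x]| = lcmn n m.
Proof.
move=> n0 m0; rewrite card_imset; last exact: token_inj.
by rewrite (card_uniqP (orbit_uniq _ _)) size_orbit order_tour.
Qed.

(** A point of [c] unvisited after [T] means that [c] is empty at one phase of every tour from [t1]
    on. Each token of the ring through [y] passes [c] at that phase, so all are dead by [tN], and
    the survivors have too few circles left. *)
Lemma resilient_lcm (n m : nat) (f g : grid n m -> R) :
  (0 < n)%N -> (0 < m)%N -> sync_schedule f g -> resilient f g (lcmn n m - 1).
Proof.
move=> n0 m0 sync S tau cardS _ pos run c theta T; apply: NNPP => ncov.
have [h [s ph]] := sync_phased n0 m0 sync; have [s0 _] := ph.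
have [_ [gE _]] := sync.
have [t1 [t1_ge t1E]] := sched_pos_reaches f theta (Rmax T 0) (gE c).
have mT := Rmax_l T 0; have m0' := Rmax_r T 0.
have unseen z k : pos k (t1 + INR z) <> Some c.
  move=> pk; have z0 := pos_INR z; apply: ncov; exists (t1 + INR z).
  split; first lra; split; first lra; split; last by exists k; left.
  exact: angeq_trans (sched_pos_add_turns f t1 z (gE c)) t1E.
pose y := invF (@token_inj n m h (clock s t1)) c.
have yE : token h (clock s t1) y = c by rewrite /y f_invF.
have N_ge0 := pos_INR #|grid n m|.
(* An orbit has at most as many elements as the grid, so by this time every token of the ring has
   had its turn on [c]. *)
pose tN := t1 + INR #|grid n m|; have tN0 : 0 <= tN by rewrite /tN; lra.
have [inj alive anti] := run_invariant ph run tN0.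
have dead x : x \in orbit (tour h) y -> ~ carried h s pos x tN.
  rewrite -fconnect_orbit (fconnect_sym (@tour_inj _ _ _)) => xy ct.
  have lez : (findex (tour h) x y <= #|grid n m|)%N.
    exact: ltnW (leq_trans (findex_max xy) (max_card _)).
  have [|k] := anti (t1 + INR (findex (tour h) x y)) x _ ct.
    have := le_INR _ _ (leP lez); have := pos_INR (findex (tour h) x y).
    by rewrite /tN; lra.
  rewrite clock_add //; last lra.
  by rewrite token_iter iter_findex // yE; apply: unseen.
pose ring := [set token h (clock s tN) x | x in orbit (tour h) y].
(* Survivors have a circle, so the default [c] is never taken. *)
have sub : [set odflt c (pos k tN) | k in ~: S] \subset ~: ring.
  apply/subsetP=> d /imsetP [k]; rewrite inE => /alive; case pk: (pos k tN) => [d'|] // _ -> /=.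
  by rewrite inE; apply/imsetP=> -[x xy dE]; apply: (dead x xy); exists k; rewrite pk dE.
have := subset_leq_card sub; rewrite card_in_imset; last first.
  move=> k1 k2; rewrite !inE => /alive; case p1: (pos k1 tN) => [d1|] // _.
  move=> /alive; case p2: (pos k2 tN) => [d2|] //= _ e.
  by apply: (inj _ _ d1); rewrite ?p1 ?p2 ?e.
have lpos : (0 < lcmn n m)%N by rewrite lcmn_gt0 n0.
have := cardsC S; have := cardsC ring; rewrite card_ring //.
by move: cardS lpos; lia.
Qed.

(** * Upper bound: a run in which one ring dies at the start *)

Definition advance (n m : nat) (swap : grid n m -> grid n m)
    (p : grid n m -> option (grid n m)) (k : grid n m) : option (grid n m) :=
  if p k is Some c then
    if [exists k', p k' == Some (swap c)] then Some c else Some (swap c)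
  else None.

Fixpoint state (n m : nat) (h : bool) (S : {set grid n m}) (e0 j : nat) :
    grid n m -> option (grid n m) :=
  if j is j'.+1 then advance (event h (e0 + j)) (state h S e0 j')
  else fun k => if k \in S then None else Some k.

Lemma advance_ok (n m : nat) (f g : grid n m -> R) (S : {set grid n m})
    (prev : grid n m -> option (grid n m)) (t : R) (swap : grid n m -> grid n m) :
  0 < t -> links_by f g t swap ->
  step_ok f g S (fun=> 0) prev t (advance swap prev).
Proof.
move=> t0 lb; apply/(step_okP _ _ _ _ lb) => k.
rewrite /advance; case pk: (prev k) => [c|//]; split=> [[_ t00]|_]; first lra.
by split=> [empty|[k' pk']]; case: existsP => // -[]; [move=> k' /eqP/empty | exists k'; apply/eqP].
Qed.

Lemma advance_id (n m : nat) (p : grid n m -> option (grid n m)) : advance id p =1 p.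
Proof. by move=> k; rewrite /advance; case: (p k) => // c; case: ifP. Qed.

(** A robot on a dead token's place would have come from, or met a robot on, that token's previous
    place, which is empty by induction. *)
Lemma state_dead (n m : nat) (h : bool) (e0 j : nat) (O : seq (grid n m)) (x k : grid n m) :
  x \in O ->
  state h [set token h e0 y | y in O] e0 j k <> Some (token h (e0 + j) x).
Proof.
move=> xO; elim: j k => [|j IHj] k.
  by rewrite addn0 /=; case: ifP => // /negP kS [ek]; apply: kS; rewrite ek imset_f.
rewrite addnS /= -addnS /advance; case sk: (state _ _ _ _ k) => [c|//].
case: ifP => [/existsP [k' /eqP sk'] [cE]|_ [/(can_inj (eventK _ _)) cE]].
  by apply: (IHj k'); rewrite sk' cE addnS eventK.
by apply: (IHj k); rewrite sk cE.
Qed.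

(** The robots that start where one ring's tokens are at reading [e0] leave at time 0. In every
    tour, between the events congruent to [e0] and [e0 + 1] modulo 4, [c] belongs to a token of that
    ring, so its point halfway is never visited. *)
Lemma not_resilient (n m : nat) (f g : grid n m -> R) (k : nat) :
  (0 < n)%N -> (0 < m)%N -> sync_schedule f g -> (lcmn n m <= k)%N ->
  ~ resilient f g k.
Proof.
move=> n0 m0 sync lek res.
have [h [s ph]] := sync_phased n0 m0 sync; have [s0 _] := ph.
have [_ [gE _]] := sync.
pose e0 := clock s 0; pose x0 : grid n m := (Ordinal n0, Ordinal m0).
pose S := [set token h e0 y | y in orbit (tour h) x0].
pose pos r t := state h S e0 (clock s t - e0) r.
have clock_ge t : 0 <= t -> (e0 <= clock s t)%N.
  move=> t0; have := clock_bounds s0 t0; have := clock_bounds s0 (Rle_refl 0).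
  rewrite -/e0 => b0 bt.
  by suff /leP : (e0 < (clock s t).+1)%coq_nat by []; apply: INR_lt; rewrite S_INR; lra.
have run : is_run f g S (fun=> 0) pos.
  split; last split.
  - move=> r t t0; have [eps [eps0 cE]] := clock_right s0 t0.
    by exists eps; split=> // u ut; rewrite /pos cE.
  - have [swap lb] := links_exist ph (Rle_refl 0).
    apply/(step_okP _ _ _ _ lb) => r; rewrite /pos subnn /=; split.
      by case=> ->.
    (* At time 0 every circle still counts as occupied, so no robot moves even if a link is
       active. *)
    move=> nleave; split=> [/(_ (swap r)) //|_].
    by case: ifP => // rS; case: nleave.
  - move=> t t0; have [eps [e [swap [eps0 cE lb swapE]]]] := links_before ph t0.
    exists eps; split=> //; exists (state h S e0 (e - e0)); split.
      by move=> r u ut; rewrite /pos cE.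
    have -> : step_ok f g S (fun=> 0) (state h S e0 (e - e0)) t (pos^~ t) <->
        step_ok f g S (fun=> 0) (state h S e0 (e - e0)) t
          (advance swap (state h S e0 (e - e0))).
      suff posE r : pos r t = advance swap (state h S e0 (e - e0)) r.
        by split=> ok r; have := ok r; rewrite posE.
      have lt0 : 0 <= t - eps / 2 by lra.
      have := clock_ge _ lt0; rewrite cE; last lra.
      move=> le; rewrite /pos; case: swapE => -[-> ->]; last by rewrite advance_id.
      by rewrite subSn //= addnS subnKC.
    exact: advance_ok.
(* [t0] is halfway between two events; it may be negative, as it serves to name an angle. *)
pose c := token h e0 x0; pose t0 := (INR e0 + 1 / 2 - s) / 4.
have cardS : (#|S| <= k)%N by rewrite card_ring.
have [t [_ [t_ge0 [[z zE] [r occ]]]]] :=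
  res S (fun=> 0) cardS (fun _ _ => Rle_refl 0) pos run c (sched_pos f g c t0) 0.
have pi0 := PI_RGT_0.
have [z' tE] : exists z' : Z, t = t0 + IZR z'.
  move: zE; rewrite /sched_pos; case: (gE c) => -> zE; [exists z|exists (- z)%Z];
    rewrite ?opp_IZR; apply: (Rmult_eq_reg_l (2 * PI)); lra.
have [lo hi] := clock_bounds s0 (Rle_refl 0); rewrite -/e0 in lo hi.
have z'0 : (0 <= z')%Z.
  by apply/Z.lt_succ_r; apply: lt_IZR; rewrite succ_IZR; move: tE; rewrite /t0; lra.
have [q qE] : exists q : nat, IZR z' = INR q.
  by exists (Z.to_nat z'); rewrite INR_IZR_INZ Z2Nat.id.
(* 1/16 of a tour is a quarter of a clock unit, too short to reach an event from halfway; the margin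
   deals with robots on [c] only just before [t]. *)
have clock_near u : t - 1 / 16 < u <= t -> clock s u = (e0 + 4 * q)%N.
  move=> ut; apply: clock_unique; rewrite plus_INR mult_INR -qE /=.
  by move: tE; rewrite /t0; lra.
have unseen u : t - 1 / 16 < u <= t -> pos r u <> Some c.
  move=> ut; rewrite /pos clock_near // addKn.
  (* After [q] more tours [c] is the place of the token [q] tours behind [x0], again in the ring. *)
  have -> : c = token h (e0 + 4 * q) (iter q (finv (tour h)) x0).
    rewrite token_iter; congr (token _ _ _).
    elim: q {qE clock_near ut} => [//|q IHq].
    by rewrite iterSr iterS f_finv //; exact: tour_inj.
  apply: state_dead; rewrite -fconnect_orbit.
  elim: (q) => [|p IHp]; first exact: connect0.
  apply: connect_trans IHp _; rewrite iterS fconnect_sym; last exact: tour_inj.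
  by apply: connect1; rewrite /= f_finv //; exact: tour_inj.
case: occ => [|[tpos [eps [eps0 occ]]]]; first by apply: unseen; lra.
have m1 := Rmin_l eps (1 / 16); have m2 := Rmin_r eps (1 / 16).
have m3 : 0 < Rmin eps (1 / 16) by apply: Rmin_glb_lt; lra.
apply: (@unseen (t - Rmin eps (1 / 16) / 2)); first lra.
by apply: occ; lra.
Qed.

Close Scope R_scope.

Theorem theorem6 (n m : nat) (f g : grid n m -> R) :
  (0 < n)%N -> (0 < m)%N ->
  sync_schedule f g ->
  uncovering_resilience f g (n * m %/ gcdn n m - 1).
Proof.
move=> n0 m0 sync; split; first exact: resilient_lcm.
move=> k res; rewrite leqNgt; apply/negP=> ltk.
apply: (@not_resilient n m f g k) => //.
(* Positivity of the lcm makes the truncated subtraction of 1 exact. *)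
by have : 0 < lcmn n m; [rewrite lcmn_gt0 n0 | move: ltk; rewrite -/(lcmn n m); lia].
Qed.
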